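(* There exists $n_0$ such that the following holds for every integer $n \geq n_0$. Let $F$ be any graph on $n$ vertices with no isolated vertices, with minimum degree $\delta(F)=\delta$ and maximum degree $\Delta(F) \leq \sqrt{n}/40$. If $G$ is an $n$-vertex graph containing no subgraph isomorphic to $F$, then $q(G) \leq q(H_{n,\delta})$, with equality if and only if $G \cong H_{n,\delta}$.
   Context: All graphs are finite and simple. For a graph $G$, $Q(G)=D(G)+A(G)$ is the signless Laplacian matrix, where $A(G)$ is the adjacency matrix and $D(G)$ the diagonal matrix of vertex degrees; $q(G)$ denotes the largest eigenvalue of $Q(G)$. For integers $n>k\geq 1$, $H_{n,k} = K_{k-1} \vee (K_{n-k} \cup K_1)$, i.e. the $n$-vertex graph consisting of a clique on $n-1$ vertices together with one additional vertex adjacent to exactly $k-1$ vertices of the clique; here $\vee$ denotes the join and $\cup$ the disjoint union. *)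

(* Defs.v *)
From HB Require Import structures.
From mathcomp Require Import all_boot all_order all_algebra.
From mathcomp Require Import boolp classical_sets reals.
Set Implicit Arguments. Unset Strict Implicit. Unset Printing Implicit Defensive.
Import Order.TTheory GRing.Theory Num.Theory.
Local Open Scope ring_scope.

Definition simple_graph (n : nat) (G : rel 'I_n) : Prop :=
  irreflexive G /\ symmetric G.

Definition deg (n : nat) (G : rel 'I_n) (v : 'I_n) : nat := #|[set u | G v u]|.

Definition adjmx (R : nzRingType) (n : nat) (G : rel 'I_n) : 'M[R]_n :=
  \matrix_(i, j) (G i j)%:R.
Definition degmx (R : nzRingType) (n : nat) (G : rel 'I_n) : 'M[R]_n :=
  \matrix_(i, j) ((i == j)%:R * (deg G i)%:R).
Definition signless_lap (R : nzRingType) (n : nat) (G : rel 'I_n) : 'M[R]_n :=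
  degmx R G + adjmx R G.

(* q(G): the largest eigenvalue of Q(G) (the supremum of its real
   eigenvalues; Q(G) is real symmetric so this set is finite, nonempty,
   and the supremum is the largest eigenvalue). *)
Definition qG (R : realType) (n : nat) (G : rel 'I_n) : R :=
  sup [set x : R | eigenvalue (signless_lap R G) x].

(* H_{n,k} = K_{k-1} v (K_{n-k} u K_1): vertices 0..n-2 form a clique,
   vertex n-1 is adjacent exactly to the vertices 0..k-2. *)
Definition Hnk (n k : nat) : rel 'I_n := fun i j =>
  (i != j) &&
  [|| ((i < n.-1)%N && (j < n.-1)%N),
      ((i == n.-1 :> nat) && (j < k.-1)%N) |
      ((j == n.-1 :> nat) && (i < k.-1)%N)].

Definition contains_copy (n : nat) (F G : rel 'I_n) : Prop :=
  exists f : 'I_n -> 'I_n, injective f /\ forall x y, F x y -> G (f x) (f y).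

Definition graph_iso (n : nat) (G H : rel 'I_n) : Prop :=
  exists f : 'I_n -> 'I_n, bijective f /\ forall x y, G x y = H (f x) (f y).
Arguments Hnk n k : clear implicits.

(* Main.v *)
Require Import Defs.
From HB Require Import structures.
From mathcomp Require Import all_boot all_order all_algebra all_fingroup.
From mathcomp Require Import zify ring lra.
Set Implicit Arguments. Unset Strict Implicit. Unset Printing Implicit Defensive.
Import Order.TTheory GRing.Theory Num.Theory.
Local Open Scope nat_scope.

(* Let C be the complement of G.

   Packing: if C has fewer than n - delta edges, then F and C pack. Place a vertex
   v1 of maximal C-degree on a vertex b of minimal F-degree, and on the neighbours
   of b a C-independent set of C-nonneighbours of v1. Such a set is left when one
   endpoint of every C-edge, the one of larger degree, is discarded; this forces
   its degrees to be O(sqrt n). Every other vertex has C-degree at most n/2; those of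
   degree above sqrt(2n) are placed greedily so that no vertex of F sees images of
   total C-degree above 3n/4. The remaining conflicts are removed by the
   Sauer-Spencer switching argument.

   Spectrum: if C has at least n - delta edges, let y be a Rayleigh vector of G with
   |y|^2 = n and e = 1 - y. As q(H) >= 2n - 4, the value q(G) >= q(H) would give
   n |e|^2 + sum_C (y_i + y_j)^2 <= 2n + 4. All but O(1) edges of C have an end with
   small e, so with s = max e = e_v the left side is at least
   n (s^2 + (2 - s)^2) + n sum_(i <> v) e_i^2 up to lower order terms; since
   s^2 + (2 - s)^2 = 2 + 2 (1 - s)^2, y is close to the indicator of the complement
   of v. For such y a missing edge at v costs less than any other missing edge, hence
   replacing C by a star at v with n - delta edges does not decrease the form, and
   increases it strictly unless C is that star. *)

(** * Counting in finite sets, and permutations matching two colourings *)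

Lemma degE (n : nat) (G : rel 'I_n) v : deg G v = \sum_u (G v u : nat).
Proof. by rewrite /deg cardsE -sum1_card big_mkcond; apply: eq_bigr => i _; rewrite unfold_in /=; case: (G v i). Qed.

Lemma card_bigcup_leq (I T : finType) (P : pred I) (S : I -> {set T}) m k :
  (forall i, P i -> #|S i| <= m) -> #|P| <= k -> #|\bigcup_(i | P i) S i| <= k * m.
Proof.
move=> Sm Pk; apply: leq_trans (_ : \sum_(i | P i) m <= _); last first.
  by rewrite sum_nat_const leq_mul2r Pk orbT.
apply: leq_trans (_ : \sum_(i | P i) #|S i| <= _); last exact: leq_sum.
elim/big_rec2: _ => [|i a B _ IH]; first by rewrite cards0.
by apply: leq_trans (leq_card_setU _ _) _; rewrite leq_add2l.
Qed.

Lemma subset_of_card (T : finType) (B : {set T}) k : k <= #|B| ->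
  exists2 U : {set T}, U \subset B & #|U| = k.
Proof.
move=> kB; have := cards_draws B k; have : 0 < 'C(#|B|, k) by rewrite bin_gt0.
by move=> /[swap] <- /card_gt0P[U]; rewrite inE => /andP[? /eqP ?]; exists U.
Qed.

(** Equal class sizes make the value lists of [a] and [b] equal as multisets, hence equal up to a
    permutation of the indices. Used for the initial placement of a packing and for the isomorphism
    with [Hnk]. *)
Lemma colored_perm (n : nat) (a b : 'I_n -> nat) :
  (forall c, #|[set i | a i == c]| = #|[set i | b i == c]|) ->
  exists p : {perm 'I_n}, forall i, b (p i) = a i.
Proof.
move=> ab; have : perm_eq [tuple a i | i < n] [tuple b i | i < n].
  have cnt c (h : 'I_n -> nat) : count_mem c [seq h i | i <- enum 'I_n] = #|[set i | h i == c]|.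
    by rewrite count_map cardsE cardE -size_filter /enum_mem; rewrite ?filter_predT; congr size; apply: eq_filter.
  by apply/allP => c _ /=; rewrite !cnt ab.
case/tuple_permP => p abp; exists p => i.
have : tnth [tuple a i | i < n] i = tnth [tuple tnth [tuple b i  | i < n] (p i) | i < n] i.
  by congr tnth; apply: val_inj.
by rewrite !tnth_mktuple.
Qed.

Lemma sqrt_floor m : exists l, l * l <= m < l.+1 * l.+1.
Proof.
elim: m => [|m [l /andP[h1 h2]]]; first by exists 0.
case: (leqP (l.+1 * l.+1) m.+1) => h; last by exists l; lia.
by exists l.+1; lia.
Qed.

(** * Packing by greedy placement and switching *)

Definition conflict_free (n : nat) (C F : rel 'I_n) (f : {perm 'I_n}) (A : {set 'I_n}) :=
  forall x y, x \in A -> y \in A -> C x y -> ~~ F (f x) (f y).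

Section Packing.
Variables (n : nat) (C F : rel 'I_n) (D : nat).
Hypotheses (Cirr : irreflexive C) (Csym : symmetric C).
Hypothesis Fsym : symmetric F.
Hypothesis degF : forall v, deg F v <= D.

(** Take a permutation with the fewest conflicts among those agreeing with [f0] on [A]. A remaining
    conflict has an end [v] outside [A]; if the images of [v] and a suitable [w] are exchanged,
    neither is in a conflict afterwards and no new one arises, contradicting minimality. The
    numerical hypothesis says that fewer than [n] choices of [w] are bad. *)
Lemma switching (A : {set 'I_n}) (f0 : {perm 'I_n}) :
  conflict_free C F f0 A ->
  (forall f : {perm 'I_n}, {in A, f =1 f0} -> forall v, v \notin A ->
     #|A| + 1 + deg C v + deg C v * D + \sum_(a | F (f v) (f a)) deg C a < n) ->
  exists f : {perm 'I_n}, conflict_free C F f [set: 'I_n].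
Proof.
move=> cf0 bad.
pose agree (f : {perm 'I_n}) := [forall x in A, f x == f0 x].
have agreeP (f : {perm 'I_n}) : reflect {in A, f =1 f0} (agree f).
  apply: (iffP forall_inP) => h x xA; first exact/eqP/h.
  by apply/eqP/h.
pose conf (f : {perm 'I_n}) := [set p : 'I_n * 'I_n | C p.1 p.2 && F (f p.1) (f p.2)].
have ag0 : agree f0 by apply/agreeP.
case: (arg_minnP (fun f : {perm 'I_n} => #|conf f|) ag0) => f /agreeP agf fmin.
suff conf0 : conf f = set0.
  exists f => x y _ _ Cxy; apply/negP => Fxy.
  by have := in_set0 (x, y); rewrite -conf0 inE /= Cxy Fxy.
apply/eqP/set0Pn => -[[u0 v0]]; rewrite inE /= => /andP[Cuv0 Fuv0].
have [u [v [Cuv Fuv vA]]] : exists u v, [/\ C u v, F (f u) (f v) & v \notin A].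
  have [v0A|v0A] := boolP (v0 \in A); last by exists u0, v0.
  exists v0, u0; split; [by rewrite Csym | by rewrite Fsym |].
  apply/negP => u0A; have := cf0 _ _ u0A v0A Cuv0.
  by rewrite -!agf // Fuv0.
(* The bad [w]. The first three sets keep [A] fixed and make [w] distinct from [v] and not
   [C]-adjacent to it. The fourth excludes conflicts at [v] once it sits on [f w], the fifth
   conflicts at [w] once it sits on [f v]. *)
pose B := A :|: [set v] :|: [set w | C v w]
   :|: (\bigcup_(a | C v a) [set w | F (f a) (f w)])
   :|: (\bigcup_(a | F (f v) (f a)) [set w | C a w]).
have cB : #|B| < n.
  apply: leq_ltn_trans (bad f agf v vA).
  apply: leq_trans (leq_card_setU _ _) _; apply: leq_add.
    apply: leq_trans (leq_card_setU _ _) _; apply: leq_add.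
      apply: leq_trans (leq_card_setU _ _) _; apply: leq_add => //.
      by apply: leq_trans (leq_card_setU _ _) _; rewrite cards1.
    apply: card_bigcup_leq => [a _|]; last by rewrite /deg cardsE.
    apply: leq_trans (degF (f a)); rewrite /deg -(card_imset _ (@perm_inj _ f)).
    apply/subset_leq_card/subsetP => y /imsetP[w]; rewrite !inE => h ->.
    exact: h.
  elim/big_rec2: _ => [|i a S _ IH]; first by rewrite cards0.
  by apply: leq_trans (leq_card_setU _ _) _; rewrite leq_add2l.
have [w wB] : exists w, w \notin B.
  apply/existsP; rewrite -negb_forall; apply/negP => /forallP allB.
  suff : n <= #|B| by rewrite leqNgt cB.
  by rewrite -{1}(card_ord n) -cardsT; apply/subset_leq_card/subsetP => x _.
move: wB; rewrite !inE !negb_or -!andbA => /and5P[wA wv Cvw /bigcupP Hw1 /bigcupP Hw2].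
pose g := (tperm v w * f)%g.
have gE x : g x = f (tperm v w x) by rewrite permM.
have gv : g v = f w by rewrite gE tpermL.
have gw : g w = f v by rewrite gE tpermR.
have gx x : x != v -> x != w -> g x = f x by move=> xv xw; rewrite gE tpermD // eq_sym.
have clean a b : C a b -> F (g a) (g b) -> a != v /\ a != w.
  move=> Cab Fab; split; apply/eqP => ea; subst a.
    have [eb|bv] := eqVneq b v; first by rewrite eb Cirr in Cab.
    have [eb|bw] := eqVneq b w; first by rewrite eb (negbTE Cvw) in Cab.
    apply: Hw1; exists b => //; rewrite inE -(gx b) // -gv Fsym.
    exact: Fab.
  have [eb|bw] := eqVneq b w; first by rewrite eb Cirr in Cab.
  have [eb|bv] := eqVneq b v; first by rewrite eb Csym (negbTE Cvw) in Cab.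
  apply: Hw2; exists b; last by rewrite inE Csym.
  by rewrite -gw -(gx b).
have clean2 a b : C a b -> F (g a) (g b) -> b != v /\ b != w.
  by rewrite Csym Fsym; apply: clean.
have agg : agree g.
  apply/agreeP => x xA; rewrite gx ?agf //.
    by apply: contraNneq vA => <-.
  by apply: contraNneq wA => <-.
have := fmin g agg; rewrite leqNgt => /negP; apply.
apply/proper_card/properP; split.
  apply/subsetP => -[a b]; rewrite !inE /= => /andP[Cab Fab].
  have [av aw] := clean _ _ Cab Fab; have [bv bw] := clean2 _ _ Cab Fab.
  by rewrite Cab -(gx a) // -(gx b).
exists (u, v); rewrite !inE /= Cuv ?Fuv //=.
by apply/negP => h; have [] := clean2 _ _ Cuv h; rewrite eqxx.
Qed.

(** The vertices of [s] are placed one at a time. The loads sum to at most [2 * n * D], so at most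
    [8 * D] vertices of [F] carry a load above n/4. If the new image is adjacent to none of these, a
    load that grows was at most n/4 and gains at most n/2, so the bound 3n/4 persists. *)
Lemma greedy_placement (A : {set 'I_n}) (f0 : {perm 'I_n}) (s : seq 'I_n) :
  conflict_free C F f0 A -> uniq s -> {in s, forall v, v \notin A} ->
  {in s, forall v, 2 * deg C v <= n} ->
  \sum_v deg C v <= 2 * n ->
  (D + 1) * (#|A| + size s) + 8 * D * D < n ->
  exists f : {perm 'I_n}, [/\ {in A, f =1 f0},
    conflict_free C F f (A :|: [set x in s]) &
    forall z, 4 * \sum_(a <- s | F z (f a)) deg C a <= 3 * n].
Proof.
move=> cf0; elim: s => [|v s IH] /=.
  move=> _ _ _ _ _; exists f0; split=> // [x y|z].
    by rewrite !inE !orbF; apply: cf0.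
  by rewrite big_nil muln0.
move=> /andP[vs us] sA sd tot bnd.
have [f [agf cf ld]] : exists f : {perm 'I_n}, [/\ {in A, f =1 f0},
    conflict_free C F f (A :|: [set x in s]) &
    forall z, 4 * \sum_(a <- s | F z (f a)) deg C a <= 3 * n].
  apply: IH => //; last by apply: leq_ltn_trans bnd; rewrite leq_add2r leq_mul2l leq_add2l leqnSn orbT.
    by move=> x xs; apply: sA; rewrite inE xs orbT.
  by move=> x xs; apply: sd; rewrite inE xs orbT.
set A' := A :|: [set x in s] in cf.
have cA' : #|A'| <= #|A| + size s.
  apply: leq_trans (leq_card_setU _ _) _; rewrite leq_add2l cardsE; exact: card_size.
have vA' : v \notin A' by rewrite !inE negb_or vs sA ?inE ?eqxx.
pose load z := \sum_(a <- s | F z (f a)) deg C a.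
pose Over := [set z | n < 4 * load z].
have n0 : 0 < n by apply: leq_trans (ltn_ord v).
have sumload : \sum_z load z <= D * (2 * n).
  apply: leq_trans (leq_mul (leqnn D) tot).
  rewrite /load; under eq_bigr do rewrite big_mkcond.
  rewrite exchange_big /=.
  apply: leq_trans (_ : \sum_(a <- s) D * deg C a <= _).
    apply: leq_sum => a _; rewrite -big_mkcond sum_nat_const leq_mul2r.
    apply/orP; right; apply: leq_trans (degF (f a)); rewrite /deg cardsE.
    by apply/subset_leq_card/subsetP => x; rewrite !unfold_in /= Fsym.
  rewrite -big_distrr /= leq_mul2l big_uniq //=; apply/orP; right.
  by rewrite [X in X <= _]big_mkcond; apply: leq_sum => i _; case: ifP.
have cOver : #|Over| <= 8 * D.
  have : #|Over| * n <= 4 * (D * (2 * n)).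
    apply: leq_trans (leq_mul (leqnn 4) sumload); rewrite -sum_nat_const big_distrr /=.
    rewrite big_mkcond; apply: leq_sum => z _; rewrite inE.
    by case: ltnP => //; apply: ltnW.
  by rewrite (_ : 4 * _ = 8 * D * n) ?leq_pmul2r //; lia.
pose B := [set f x | x in A'] :|: (\bigcup_(a in A') [set y | F (f a) y])
   :|: (\bigcup_(z in Over) [set y | F z y]).
have cB : #|B| < n.
  apply: leq_ltn_trans bnd.
  have h1 : #|[set f x | x in A']| <= #|A| + (size s).+1.
    by rewrite card_imset ?addnS; [exact: leqW | exact: perm_inj].
  have h2 : #|\bigcup_(a in A') [set y | F (f a) y]| <= (#|A| + (size s).+1) * D.
    apply: card_bigcup_leq => [i _|]; first exact: degF.
    by rewrite addnS; exact: leqW.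
  have h3 : #|\bigcup_(z in Over) [set y | F z y]| <= 8 * D * D.
    by apply: card_bigcup_leq => [i _|]; first exact: degF.
  apply: leq_trans (leq_card_setU _ _) _; apply: leq_add => //.
  apply: leq_trans (leq_card_setU _ _) _.
  by rewrite mulnDl mul1n addnC; apply: leq_add => //; rewrite mulnC.
have [y yB] : exists y, y \notin B.
  apply/existsP; rewrite -negb_forall; apply/negP => /forallP allB.
  suff : n <= #|B| by rewrite leqNgt cB.
  by rewrite -{1}(card_ord n) -cardsT; apply/subset_leq_card/subsetP => x _.
move: yB; rewrite !in_setU !negb_or -andbA => /and3P[yA /bigcupP Hy1 /bigcupP Hy2].
(* Moving [v] onto [y] sends the former occupant [w] of [y] to the old place of [v]. As [y] is not
   an image of [A'], no vertex placed earlier moves. *)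
pose w := (f^-1)%g y.
have fw : f w = y by rewrite /w permKV.
pose g := (tperm v w * f)%g.
have gE x : g x = f (tperm v w x) by rewrite permM.
have gv : g v = y by rewrite gE tpermL.
have gA x : x \in A' -> g x = f x.
  move=> xA; rewrite gE tpermD //.
    by apply: contraNneq vA' => ->.
  apply: contraNneq yA => wx; apply/imsetP; exists x => //.
  by rewrite -wx fw.
exists g; split.
- by move=> x xA; rewrite gA ?agf // inE xA.
- have inA' x : x \in A :|: [set x in v :: s] -> x = v \/ x \in A'.
    by rewrite !inE => /or3P[->|/eqP->|->]; rewrite ?orbT; auto.
  move=> x x' /inA'[->|xA] /inA'[->|x'A] Cxx; first by rewrite Cirr in Cxx.
  + rewrite gv gA //; apply/negP => h; apply: Hy1; exists x' => //.
    by rewrite inE Fsym.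
  + rewrite gv gA //; apply/negP => h; apply: Hy1; exists x => //.
    by rewrite inE.
  + by rewrite !gA //; apply: cf.
- move=> z; rewrite big_cons gv.
  have -> : \sum_(j <- s | F z (g j)) deg C j = load z.
    rewrite /load big_seq_cond [RHS]big_seq_cond; apply: eq_bigl => j.
    by case js: (j \in s) => //=; rewrite gA // !inE js orbT.
  case: ifP => Fzy; last exact: ld.
  have := sd v; rewrite inE eqxx => /(_ isT) dv.
  suff : 4 * load z <= n by lia.
  by rewrite leqNgt; apply/negP => h; apply: Hy2; exists z; rewrite inE.
Qed.

End Packing.

(** Order the vertices by degree, ties broken by index, and delete the higher end of every [C]-edge,
    besides [v1] and its neighbours. What survives is independent. All neighbours of a survivor [u]
    have degree at least that of [u], so the square of its degree is at most the sum of all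
    degrees. *)
Lemma low_independent_set (n : nat) (C : rel 'I_n) (v1 : 'I_n) (delta : nat) :
  irreflexive C -> symmetric C -> delta <= n ->
  \sum_v deg C v < 2 * (n - delta) ->
  exists U : {set 'I_n}, [/\ #|U| = delta, v1 \notin U,
    {in U, forall u, ~~ C v1 u}, {in U &, forall u w, ~~ C u w} &
    {in U, forall u, deg C u * deg C u <= 2 * n}].
Proof.
move=> Cirr Csym dn tot.
pose d u := deg C u.
pose low (w u : 'I_n) := (d w < d u) || ((d w == d u) && (w < u)).
have low_tot w u : w != u -> (low w u : nat) + low u w = 1.
  move=> /eqP wu; have {}wu : (w : nat) <> u by move=> /val_inj.
  by rewrite /low; lia.
pose a u w : nat := C u w && low w u.
have aE u w : a u w + a w u = C u w.
  rewrite /a (Csym w u); have [->|wu] := eqVneq u w; first by rewrite Cirr.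
  by case: (C u w) => //=; rewrite low_tot // eq_sym.
pose Del := [set u | [&& u != v1, ~~ C v1 u & [exists w, C u w && low w u]]].
pose U0 := [set u | [&& u != v1, ~~ C v1 u & ~~ [exists w, C u w && low w u]]].
have suma : 2 * (\sum_u \sum_w a u w) = \sum_v deg C v.
  rewrite mul2n -addnn {2}exchange_big /= -big_split /=; apply: eq_bigr => u _.
  by rewrite -big_split degE; apply: eq_bigr => w _; rewrite -aE.
have sumDel : #|Del| + deg C v1 <= \sum_u \sum_w a u w.
  (* Each unit on the left is charged to its own edge, recorded in the row of the higher end. An
     edge at [v1] falls in row [v1] or in the row of the neighbour; a vertex of [Del] pays with one
     edge of its own row. Hence at most e(C) < n - delta vertices are lost besides [v1]. *)
  have -> : #|Del| + deg C v1 = \sum_u ((u \in Del : nat) + (u == v1) * (\sum_w a v1 w) + C v1 u * a u v1).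
    rewrite !big_split /= -addnA; congr (_ + _).
      by rewrite -sum1_card big_mkcond; apply: eq_bigr => u _; case: (u \in Del).
    rewrite (bigD1 v1) //= eqxx mul1n [X in _ + X + _]big1 ?addn0 => [|i /negbTE->] //.
    rewrite degE -big_split; apply: eq_bigr => w _ /=.
    by rewrite -[LHS]aE /a (Csym w v1); case: (C v1 w); rewrite ?mul1n.
  apply: leq_sum => u _; rewrite inE; have [->|uv1] /= := eqVneq u v1.
    by rewrite Cirr mul0n mul1n addn0.
  rewrite mul0n addn0; case Cu: (C v1 u) => /=.
    by rewrite mul1n (bigD1 v1) //= leq_addr.
  rewrite mul0n addn0; case: existsP => // -[w /= h].
  by rewrite (bigD1 w) //= /a h.
have part : #|U0| + #|Del| + deg C v1 + 1 = n.
  rewrite -[RHS]card_ord -sum1_card degE -!sum1_card [in X in X + _ + _ + _]big_mkcond /=.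
  rewrite [in X in _ + X + _ + _]big_mkcond /= -[X in _ + X = _](_ : \sum_u (u == v1 : nat) = 1); last first.
    by rewrite (bigD1 v1) //= eqxx big1 ?addn0 // => i /negbTE->.
  rewrite -!big_split /=; apply: eq_bigr => u _; rewrite !inE.
  have [->|uv1] /= := eqVneq u v1; first by rewrite Cirr.
  by case: (C v1 u); case: existsP.
have cU0 : delta <= #|U0| by lia.
have [U UU0 cU] := subset_of_card cU0.
have inU u : u \in U -> [/\ u != v1, ~~ C v1 u & forall w, C u w -> ~~ low w u].
  move/(subsetP UU0); rewrite inE => /and3P[? ?] /existsPn h; split=> // w Cuw.
  by have := h w; rewrite Cuw.
exists U; split=> //.
- by apply/negP => /inU[]; rewrite eqxx.
- by move=> u /inU[].
- move=> u w /inU[_ _ hu] /inU[_ _ hw]; apply/negP => Cuw.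
  have := low_tot w u; have -> : w != u by apply: contraTneq Cuw => ->; rewrite Cirr.
  by move=> /(_ isT); rewrite (negbTE (hu _ Cuw)) (negbTE (hw _ _)) // Csym.
- move=> u /inU[_ _ hu]; apply: leq_trans (_ : \sum_v deg C v <= _); last by lia.
  rewrite {1}degE big_distrl /=; apply: leq_sum => w _.
  case Cuw: (C u w); rewrite ?mul0n // mul1n.
  by have := hu w Cuw; rewrite /low negb_or -leqNgt => /andP[].
Qed.

(** Only a possible edge between [v] and [w] is counted twice among the edges at [v] or [w]. It
    follows that a vertex other than one of maximal degree has degree at most n/2 when [C] has fewer
    than n edges. *)
Lemma sum_two_degrees (n : nat) (C : rel 'I_n) (v w : 'I_n) :
  irreflexive C -> symmetric C -> v != w ->
  2 * (deg C v + deg C w) <= \sum_u deg C u + 2.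
Proof.
move=> Cirr Csym vw.
have delta1 (x : 'I_n) k : \sum_u (u == x) * k = k.
  by rewrite (bigD1 x) //= eqxx mul1n big1 ?addn0 // => i /negbTE->.
have -> : 2 * (deg C v + deg C w) = \sum_u (C v u + C w u + (u == v) * deg C v + (u == w) * deg C w).
  by rewrite !big_split /= !delta1 -!degE; lia.
have -> : \sum_u deg C u + 2 = \sum_u (deg C u + (u == v) * 1 + (u == w) * 1).
  by rewrite !big_split /= !delta1; lia.
apply: leq_sum => u _.
have [->|uv] := eqVneq u v.
  by rewrite (negbTE vw) Cirr; case: (C w v) => /=; lia.
have [->|uw] := eqVneq u w.
  by rewrite Cirr; case: (C v w) => /=; lia.
have : C u v + C u w <= deg C u.
  by rewrite degE (bigD1 v) //= (bigD1 w) 1?eq_sym //=; lia.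
by rewrite (Csym v) (Csym w); lia.
Qed.

Lemma sparse_packing (n D : nat) (F C : rel 'I_n) (b : 'I_n) :
  100 * 100 <= n -> 1600 * (D * D) <= n ->
  irreflexive F -> symmetric F -> irreflexive C -> symmetric C ->
  (forall v, deg F v <= D) ->
  \sum_v deg C v < 2 * (n - deg F b) ->
  exists f : {perm 'I_n}, forall x y, C x y -> ~~ F (f x) (f y).
Proof.
move=> nbig Dn Firr Fsym Cirr Csym degF tot.
have [v1 _ v1max] := @arg_maxnP _ b (fun _ => true) (fun v => deg C v) isT.
have dn : deg F b <= n by have := degF b; nia.
have [U [cU v1U CU indU lowU]] := low_independent_set v1 Cirr Csym dn tot.
have [l /andP[l1 l2]] := sqrt_floor (2 * n).
(* The classes [v1], [U], rest are matched with [b], the neighbours of [b], rest; the sizes agree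
   because [U] has exactly [deg F b] elements. *)
have [f0 f0E] : exists f0 : {perm 'I_n}, forall i,
    (if f0 i == b then 0 else if F b (f0 i) then 1 else 2) =
    (if i == v1 then 0 else if i \in U then 1 else 2).
  pose ca i := if i == v1 then 0 else if i \in U then 1 else 2.
  pose cb i := if i == b then 0 else if F b i then 1 else 2.
  apply: (@colored_perm n ca cb).
  have a0 : [set i | ca i == 0] = [set v1].
    by apply/setP => i; rewrite !inE /ca; case: (i == v1); case: (i \in U).
  have b0 : [set i | cb i == 0] = [set b].
    by apply/setP => i; rewrite !inE /cb; case: (i == b); case: (F b i).
  have a1 : [set i | ca i == 1] = U.
    apply/setP => i; rewrite !inE /ca; have [->|_] := eqVneq i v1; last by case: (i \in U).
    by rewrite (negbTE v1U).
  have b1 : [set i | cb i == 1] = [set i | F b i].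
    apply/setP => i; rewrite !inE /cb; have [->|_] := eqVneq i b; last by case: (F b i).
    by rewrite Firr.
  have a2 : [set i | ca i == 2] = ~: ([set v1] :|: U).
    by apply/setP => i; rewrite !inE /ca; case: (i == v1); case: (i \in U).
  have b2 : [set i | cb i == 2] = ~: ([set b] :|: [set i | F b i]).
    by apply/setP => i; rewrite !inE /cb; case: (i == b); case: (F b i).
  have cardU1 (x : 'I_n) (S : {set 'I_n}) : x \notin S -> #|[set x] :|: S| = #|S|.+1.
    by move=> xS; rewrite cardsU1 xS.
  move=> [|[|[|c]]]; first by rewrite a0 b0 !cards1.
  - by rewrite a1 b1 cU.
  - by rewrite a2 b2 [LHS]cardsCs [RHS]cardsCs !setCK !cardU1 ?inE ?Firr // cU.
  - have -> : [set i | ca i == c.+3] = set0.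
      by apply/setP => i; rewrite !inE /ca; case: (i == v1); case: (i \in U).
    have -> // : [set i | cb i == c.+3] = set0.
      by apply/setP => i; rewrite !inE /cb; case: (i == b); case: (F b i).
have f0v1 : f0 v1 = b.
  by have := f0E v1; rewrite eqxx; case: eqP => //; case: (F b _).
have f0U i : F b (f0 i) = (i \in U).
  have := f0E i; have [->|iv1] := eqVneq i v1.
    by rewrite f0v1 Firr (negbTE v1U).
  case: eqP => [->|_]; first by case: (i \in U).
  by case: (F b _); case: (i \in U).
pose A := v1 |: U.
have cA : #|A| = (deg F b).+1 by rewrite cardsU1 v1U cU.
have cf0 : conflict_free C F f0 A.
  move=> x y; rewrite !inE => /orP[/eqP->|xU] /orP[/eqP->|yU].
  - by rewrite Cirr.
  - by rewrite (negbTE (CU _ yU)).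
  - by rewrite Csym (negbTE (CU _ xU)).
  - by rewrite (negbTE (indU _ _ xU yU)).
(* With [l] the integer part of the root of 2n, more than [l] vertices of degree at least [l + 1]
   would give a degree sum of at least (l + 1)^2 > 2n. *)
pose Hi := enum [set v | (v \notin A) && (l < deg C v)].
have HiE v : v \in Hi = (v \notin A) && (l < deg C v) by rewrite mem_enum inE.
have tot2 : \sum_v deg C v <= 2 * n by lia.
have sHi : size Hi <= l.
  rewrite -ltnS -(@ltn_pmul2r l.+1) //; apply: leq_ltn_trans l2.
  apply: leq_trans tot2; rewrite -cardE -sum_nat_const big_mkcond.
  by apply: leq_sum => v _; rewrite inE; case: ifP => // /andP[].
(* From [D^2 <= n / 1600] and [l^2 <= 2 * n]: the square of 28 D l is at most 784 * 2 / 1600 < 1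
   times n^2. *)
have Dl : 28 * (D * l) <= n.
  rewrite -leq_sqr -!mulnn; have := leq_mul Dn l1; nia.
have l70 : 70 * l <= n.
  rewrite -leq_sqr -!mulnn; have := leq_mul nbig (leqnn n); lia.
have D1 : 1600 * D <= n by nia.
have db := degF b.
have D8 : (deg F b).+1 + size Hi <= D + 1 + l by lia.
have [f1 [f1A cf1 ld]] : exists f : {perm 'I_n}, [/\ {in A, f =1 f0},
    conflict_free C F f (A :|: [set x in Hi]) &
    forall z, 4 * \sum_(a <- Hi | F z (f a)) deg C a <= 3 * n].
  apply: (greedy_placement Cirr Fsym degF cf0 (enum_uniq _)) => //.
  - by move=> v; rewrite HiE => /andP[].
  - move=> v; rewrite HiE !inE negb_or => /andP[/andP[vv1 _] _].
    have := sum_two_degrees Cirr Csym vv1; have := v1max v isT; lia.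
  - rewrite cA; apply: leq_ltn_trans (_ : (D + 1) * (D + 1 + l) + 8 * D * D < n).
      by rewrite leq_add2r leq_mul2l D8 orbT.
    by nia.
have [f cff] : exists f : {perm 'I_n}, conflict_free C F f [set: 'I_n].
  apply: (switching Cirr Csym Fsym degF cf1) => f agf v vA.
  have agA : {in A, f =1 f0} by move=> x xA; rewrite agf ?f1A // inE xA.
  have [vA0 dv] : v \notin A /\ deg C v <= l.
    move: vA; rewrite inE [v \in [set x in Hi]]inE HiE negb_or => /andP[-> /=].
    by rewrite -leqNgt.
  have cA1 : #|A :|: [set x in Hi]| <= D + 1 + l.
    apply: leq_trans (leq_card_setU _ _) _; rewrite cA cardsE.
    by apply: leq_trans D8; rewrite leq_add2l card_size.
  (* All [F]-neighbours of [b] are images of [U], and [v] lies outside [U]. So the possibly huge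
     degree of [v1] never enters the load seen from [f v]. *)
  have Fv1 : ~~ F (f v) (f v1).
    have -> : f v1 = b by rewrite agA ?f0v1 // in_setU1 eqxx.
    rewrite Fsym; apply/negP => h.
    have : f0 ((f0^-1)%g (f v)) = f v by rewrite permKV.
    set u := (f0^-1)%g _ => fu.
    have uU : u \in U by rewrite -f0U fu.
    have : f u = f v by rewrite agA ?fu // inE uU orbT.
    by move/perm_inj => uv; move: vA0; rewrite -uv inE uU orbT.
  (* Apart from [Hi] and [v1], every vertex has [C]-degree at most [l]: those of [U] by [lowU], the
     others by the choice of [Hi]. *)
  have load : \sum_(a | F (f v) (f a)) deg C a <=
      \sum_(a <- Hi | F (f v) (f1 a)) deg C a + D * l.
    rewrite (bigID (mem Hi)) /=; apply: leq_add.
      rewrite [leqRHS]big_mkcond (big_uniq _ (enum_uniq _)) /=.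
      rewrite [leqRHS]big_mkcond [leqLHS]big_mkcond; apply: leq_sum => a _.
      case aHi: (a \in Hi); last by rewrite andbF.
      by rewrite (agf a) ?andbT // in_setU [a \in [set x in Hi]]inE aHi orbT.
    apply: leq_trans (_ : \sum_(i | F (f v) (f i)) l <= _).
      rewrite big_mkcondr; apply: leq_sum => a Fa; case: ifP => //.
      rewrite HiE => /nandP[|]; last by rewrite -leqNgt.
      rewrite negbK !inE => /orP[/eqP av1|aU]; first by rewrite -av1 Fa in Fv1.
      have := lowU _ aU; rewrite leqNgt => h; rewrite leqNgt; apply: contra h => h.
      by apply: leq_trans l2 _; rewrite leq_mul.
    rewrite sum_nat_const leq_mul2r; apply/orP; right.
    apply: leq_trans (degF (f v)); rewrite /deg -(card_imset _ (@perm_inj _ f)).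
    by apply/subset_leq_card/subsetP => y /imsetP[w]; rewrite !inE => h ->.
  have := ld (f v); have : deg C v * D <= D * l by rewrite mulnC leq_mul2l dv orbT.
  have arith (c s1 s2 t d m : nat) : c <= D + 1 + l -> s1 <= s2 + m -> 4 * s2 <= 3 * n ->
      t <= m -> d <= l -> 28 * m <= n -> c + 1 + d + t + s1 < n by clear - nbig l70 D1; lia.
  by move=> h1 h2; apply: (arith _ _ _ _ _ _ cA1 load h2 h1 dv Dl).
by exists f => x y; apply: cff; rewrite inE.
Qed.

From mathcomp Require Import boolp classical_sets reals.
Import Order.TTheory GRing.Theory Num.Theory.
Local Open Scope ring_scope.

(** * Rayleigh quotients and the signless Laplacian *)

Definition mxform (R : realType) (n : nat) (A : 'M[R]_n) (x : 'rV[R]_n) : R :=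
  (x *m A *m x^T) 0 0.
Definition sqnorm (R : realType) (n : nat) (x : 'rV[R]_n) : R := \sum_i x 0 i ^+ 2.

Section Rayleigh.
Variables (R : realType) (n : nat).
Implicit Types (A : 'M[R]_n) (x : 'rV[R]_n).

Lemma sqnormE x : (x *m x^T) 0 0 = sqnorm x.
Proof. by rewrite mxE; apply: eq_bigr => i _; rewrite mxE expr2. Qed.

Lemma sqnorm_ge0 x : 0 <= sqnorm x.
Proof. by apply: sumr_ge0 => i _; apply: sqr_ge0. Qed.

Lemma sqnorm_gt0 x : x != 0 -> 0 < sqnorm x.
Proof.
move=> x0; rewrite lt_neqAle sqnorm_ge0 andbT eq_sym; apply: contraNneq x0 => s0.
apply/eqP/rowP => i; rewrite mxE; apply/eqP; rewrite -sqrf_eq0.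
move/eqP: s0; rewrite psumr_eq0 => [/allP h|j _]; last exact: sqr_ge0.
by have := h i; rewrite mem_index_enum => /(_ isT).
Qed.

Lemma mxformE A x : mxform A x = \sum_i \sum_j x 0 i * A i j * x 0 j.
Proof.
rewrite /mxform mxE exchange_big; apply: eq_bigr => j _.
by rewrite !mxE mulr_suml.
Qed.

Lemma mxform_bound A : exists2 K, 0 < K & forall x, mxform A x <= K * sqnorm x.
Proof.
exists (1 + \sum_i \sum_j `|A i j|).
  by rewrite ltr_pwDl // sumr_ge0 // => i _; apply: sumr_ge0.
move=> x; rewrite mulrDl mul1r mxformE mulr_suml ler_wpDl ?sqnorm_ge0 //.
apply: ler_sum => i _; rewrite mulr_suml; apply: ler_sum => j _.
have le k : x 0 k ^+ 2 <= sqnorm x.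
  by rewrite /sqnorm (bigD1 k) //= lerDl sumr_ge0 // => l _; apply: sqr_ge0.
have := le i; have := le j; set a := x 0 i; set b := x 0 j; set S := sqnorm x => hb ha.
apply: le_trans (ler_norm _) _; rewrite !normrM mulrAC mulrC ler_wpM2l //.
have := real_normK (num_real a); have := real_normK (num_real b).
have := sqr_ge0 (`|a| - `|b|); move: `|a| `|b| => c d; nra.
Qed.

Lemma mxform_scalar_sub A (c : R) x : mxform (c%:M - A) x = c * sqnorm x - mxform A x.
Proof.
rewrite /mxform mulmxBr mulmxBl mul_mx_scalar -scalemxAl [LHS]mxE.
by rewrite [X in X + _]mxE [X in _ + X]mxE sqnormE.
Qed.

(** Evaluate the form at [x - K^-1 *: z], with [z = x *m invmx A] and [K] an upper bound for the
    form of the inverse. Nonnegativity gives form(x) - 2 |x|^2 / K + |x|^2 / K >= 0. *)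
Lemma psd_unit_coercive A : A^T = A -> A \in unitmx ->
  (forall x, 0 <= mxform A x) ->
  exists2 K, 0 < K & forall x, sqnorm x <= K * mxform A x.
Proof.
move=> symA unitA psd; have [K K0 HK] := mxform_bound (invmx A).
exists K => // x; pose z := x *m invmx A.
have zA : z *m A = x by rewrite /z mulmxKV.
have tK : K * K^-1 = 1 by rewrite divff ?gt_eqF.
have Azt : A *m z^T = x^T by rewrite -{1}symA -trmx_mul zA.
have := psd (x - K^-1 *: z).
have -> : mxform A (x - K^-1 *: z) = mxform A x - K^-1 * sqnorm x *+ 2 + K^-1 ^+ 2 * mxform (invmx A) x.
  have trB : (x - K^-1 *: z)^T = x^T - K^-1 *: z^T by apply/matrixP => i j; rewrite !mxE.
  rewrite /mxform trB !(mulmxBl, mulmxBr) -!scalemxAl -!scalemxAr zA.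
  rewrite -[x *m A *m z^T]mulmxA Azt -/z.
  have -> : x *m z^T = z *m x^T by rewrite -[LHS]trmxK trmx_mul trmxK; apply/matrixP => i j; rewrite !ord1 [LHS]mxE.
  have entB (P Q : 'M[R]_1) : (P - Q) 0 0 = P 0 0 - Q 0 0 by rewrite !mxE.
  have entZ k (P : 'M[R]_1) : (k *: P) 0 0 = k * P 0 0 by rewrite mxE.
  by rewrite !(entB, entZ) sqnormE /z; ring.
have := HK x; set b := mxform (invmx A) x; set a := mxform A x; set s := sqnorm x.
move=> h1 h2; rewrite -(ler_pM2l (_ : 0 < K^-1)) ?invr_gt0 // mulrA mulVf ?gt_eqF // mul1r.
have : K^-1 ^+ 2 * b <= K^-1 ^+ 2 * (K * s) by rewrite ler_wpM2l ?sqr_ge0.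
have -> : K^-1 ^+ 2 * (K * s) = K^-1 * s by rewrite expr2 -mulrA (mulrA _ K) mulVf ?gt_eqF // mul1r.
lra.
Qed.

(** Let [c] be the infimum of the upper bounds of the Rayleigh quotient. Then [c%:M - A] is positive
    semidefinite. Were it invertible, coercivity would make [c - K^-1] an upper bound too; so it is
    singular, and a kernel vector is an eigenvector for [c]. *)
Lemma symmetric_max_eigen A : (0 < n)%N -> A^T = A ->
  exists2 c, eigenvalue A c & forall x, mxform A x <= c * sqnorm x.
Proof.
move=> n0 symA.
pose B : set R := [set c | forall x, mxform A x <= c * sqnorm x]%classic.
have ratio x c : x != 0 -> (mxform A x <= c * sqnorm x) = (mxform A x / sqnorm x <= c).
  by move=> x0; rewrite ler_pdivrMr ?sqnorm_gt0.
have B0 : (B !=set0)%classic by have [K _ HK] := mxform_bound A; exists K.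
have lbB x : x != 0 -> lbound B (mxform A x / sqnorm x).
  by move=> x0 c Bc; rewrite -ratio.
have infB : has_inf B.
  split=> //; exists (mxform A (const_mx 1) / sqnorm (const_mx 1 : 'rV[R]_n)); apply: lbB.
  by apply/eqP => /rowP /(_ (Ordinal n0)); rewrite !mxE => /eqP; rewrite oner_eq0.
pose c := inf B.
have Bc x : mxform A x <= c * sqnorm x.
  have [->|x0] := eqVneq x 0.
    rewrite mxformE big1 => [|i _]; last by rewrite big1 // => j _; rewrite mxE !mul0r.
    by rewrite /sqnorm big1 ?mulr0 // => i _; rewrite mxE expr0n.
  by rewrite ratio //; apply: lb_le_inf => //; apply: lbB.
exists c => //.
have [unitN|] := boolP (c%:M - A \in unitmx); last first.
  rewrite -row_free_unit -kermx_eq0 => /rowV0Pn[x /sub_kermxP].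
  rewrite mulmxBr mul_mx_scalar => /eqP; rewrite subr_eq0 => /eqP h x0.
  by apply/eigenvalueP; exists x.
have [K K0 HK] : exists2 K, 0 < K & forall x, sqnorm x <= K * mxform (c%:M - A) x.
  apply: psd_unit_coercive => //.
    by rewrite linearB /= tr_scalar_mx symA.
  by move=> x; rewrite mxform_scalar_sub subr_ge0.
have : c <= c - K^-1.
  apply: ge_inf; first by have [_] := infB.
  move=> x; have := HK x; rewrite mxform_scalar_sub -(ler_pM2l (_ : 0 < K^-1)) ?invr_gt0 //.
  by rewrite mulrA mulVf ?gt_eqF // mul1r mulrBl; lra.
by rewrite lerBrDl gerDr leNgt invr_gt0 K0.
Qed.

Lemma eigenvalue_mxform A c : eigenvalue A c ->
  exists2 x, x != 0 & mxform A x = c * sqnorm x.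
Proof.
case/eigenvalueP => x xA x0; exists x => //.
by rewrite /mxform xA -scalemxAl mxE sqnormE.
Qed.

End Rayleigh.

(** * The signless Laplacian as a sum of squares over edges *)

Section Signless.
Variables (R : realType) (n : nat).
Implicit Types (G : rel 'I_n) (x : 'rV[R]_n).

(** The sum runs over ordered pairs, so every edge counts twice; hence the factors 2 in front of
    [qG] below. *)
Definition edge_form G x : R := \sum_i \sum_j (G i j)%:R * (x 0 i + x 0 j) ^+ 2.

Lemma edge_formE G x : symmetric G ->
  edge_form G x = 2 * mxform (signless_lap R G) x.
Proof.
move=> symG; rewrite mxformE /edge_form.
transitivity (\sum_i \sum_j (((G i j)%:R * x 0 i ^+ 2 + (G i j)%:R * x 0 j ^+ 2) + 2 * ((G i j)%:R * x 0 i * x 0 j))).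
  by apply: eq_bigr => i _; apply: eq_bigr => j _; ring.
under eq_bigr do rewrite 2!big_split /=.
rewrite 2!big_split /= [X in _ + X + _]exchange_big /=.
under [X in _ + X + _]eq_bigr do under eq_bigr do rewrite symG.
rewrite -mulr2n.
under [X in _ + X]eq_bigr do rewrite -mulr_sumr.
rewrite -mulr_sumr -[X in X + _]mulr_natl -mulrDr -big_split; congr (2 * _); apply: eq_bigr => i _ /=.
rewrite /signless_lap.
transitivity (\sum_j (x 0 i * ((i == j)%:R * (deg G i)%:R) * x 0 j + (G i j)%:R * x 0 i * x 0 j)).
  rewrite big_split /=; congr (_ + _).
  rewrite [RHS](bigD1 i) //= eqxx mul1r [X in _ = _ + X]big1 ?addr0; last first.
    by move=> j /negbTE; rewrite eq_sym => ->; rewrite !(mul0r, mulr0).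
  rewrite -mulr_suml -natr_sum.
  rewrite -degE.
  by ring.
by apply: eq_bigr => j _; rewrite !mxE; ring.
Qed.

Lemma signless_lap_sym G : symmetric G -> (signless_lap R G)^T = signless_lap R G.
Proof.
move=> symG; apply/matrixP => i j; rewrite !mxE symG; congr (_ + _).
by rewrite eq_sym; case: eqVneq => [->|] //; rewrite !mul0r.
Qed.

(** Eigenvalues are values of the Rayleigh quotient, so the maximal [c] bounds them all and belongs
    to the set. The set is thus nonempty and bounded, and its supremum is not a default value. *)
Lemma qG_eigen G : (0 < n)%N -> symmetric G ->
  eigenvalue (signless_lap R G) (qG R G) /\
  forall x, edge_form G x <= 2 * qG R G * sqnorm x.
Proof.
move=> n0 symG.
have [c eigc maxc] := symmetric_max_eigen n0 (signless_lap_sym symG).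
suff -> : qG R G = c by split=> // x; rewrite edge_formE // -mulrA ler_wpM2l.
have ubc : ubound [set x : R | eigenvalue (signless_lap R G) x]%classic c.
  move=> d /= /eigenvalue_mxform[x x0 h]; have := maxc x.
  by rewrite h ler_pM2r ?sqnorm_gt0.
apply/eqP; rewrite eq_le; apply/andP; split.
  by apply: ge_sup => //; exists c.
by apply: ub_le_sup => //; exists c.
Qed.

(** Scaling to squared norm [n] makes the all-ones vector the reference point, and the sign is
    chosen so that the eigenvector lies on its side. *)
Lemma qG_attained G : (0 < n)%N -> symmetric G ->
  exists x, [/\ sqnorm x = n%:R, 0 <= \sum_i x 0 i &
    edge_form G x = 2 * qG R G * n%:R].
Proof.
move=> n0 symG; have [/eigenvalue_mxform[x x0 h] _] := qG_eigen n0 symG.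
have sx := sqnorm_gt0 x0.
have sqZ t : sqnorm (t *: x) = t ^+ 2 * sqnorm x.
  by rewrite /sqnorm mulr_sumr; apply: eq_bigr => i _; rewrite mxE exprMn.
have sumZ t : \sum_i (t *: x) 0 i = t * \sum_i x 0 i.
  by rewrite mulr_sumr; apply: eq_bigr => i _; rewrite mxE.
have mxZ t : mxform (signless_lap R G) (t *: x) = qG R G * sqnorm (t *: x).
  by rewrite sqZ mulrCA -h /mxform linearZ /= -!scalemxAl -scalemxAr scalerA -expr2 mxE.
pose s := Num.sqrt (n%:R / sqnorm x).
have s2 : s ^+ 2 * sqnorm x = n%:R.
  by rewrite sqr_sqrtr ?divr_ge0 ?ler0n ?sqnorm_ge0 // divfK ?gt_eqF.
have s0 : 0 <= s by apply: sqrtr_ge0.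
have done_ t : t ^+ 2 = s ^+ 2 -> 0 <= t * \sum_i x 0 i -> exists x, [/\ sqnorm x = n%:R, 0 <= \sum_i x 0 i &
    edge_form G x = 2 * qG R G * n%:R].
  move=> ts pos; exists (t *: x); rewrite sqZ ts s2 sumZ edge_formE // mxZ sqZ ts s2 mulrA.
  by split.
have [p|p] := lerP 0 (\sum_i x 0 i); first by apply: (done_ s) => //; rewrite mulr_ge0.
by apply: (done_ (- s)); rewrite ?sqrrN // mulNr -mulrN mulr_ge0 // oppr_ge0 ltW.
Qed.

Lemma edge_form_iso G H (f : 'I_n -> 'I_n) x : bijective f ->
  (forall i j, G i j = H (f i) (f j)) ->
  edge_form H x = edge_form G (\row_i x 0 (f i)).
Proof.
move=> bf GH; rewrite /edge_form (reindex f) /=; last exact: onW_bij.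
apply: eq_bigr => i _; rewrite (reindex f) /=; last exact: onW_bij.
by apply: eq_bigr => j _; rewrite GH !mxE.
Qed.

Lemma qG_iso_le G H : (0 < n)%N -> symmetric G -> symmetric H ->
  graph_iso G H -> qG R H <= qG R G.
Proof.
move=> n0 symG symH [f [bf GH]].
have [x [xn _ xH]] := qG_attained n0 symH.
have [_ /(_ (\row_i x 0 (f i)))] := qG_eigen n0 symG.
rewrite -(edge_form_iso _ bf GH) xH.
have -> : sqnorm (\row_i x 0 (f i)) = n%:R.
  by rewrite -xn /sqnorm [RHS](reindex f) /=; [apply: eq_bigr => i _; rewrite mxE | exact: onW_bij].
have cancel (a b : R) : 2 * a * n%:R <= 2 * b * n%:R -> a <= b.
  by rewrite ler_pM2r ?ltr0n // ler_pM2l // ltr0n.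
exact: cancel.
Qed.

Lemma qG_iso G H : (0 < n)%N -> symmetric G -> symmetric H ->
  graph_iso G H -> qG R G = qG R H.
Proof.
move=> n0 symG symH iso; apply/eqP; rewrite eq_le; apply/andP; split; last exact: (qG_iso_le n0 symG symH iso).
case: iso => f [[g fK gK] GH]; apply: (qG_iso_le n0 symH symG); exists g; split.
  by exists f.
by move=> x y; rewrite GH !gK.
Qed.

End Signless.

(** * Complements with at least as many edges as the star *)

Definition compl_rel (n : nat) (C : rel 'I_n) : rel 'I_n :=
  fun i j => (i != j) && ~~ C i j.

Definition star_rel (n : nat) (v : 'I_n) (W : {set 'I_n}) : rel 'I_n :=
  fun i j => ((i == v) && (j \in W)) || ((j == v) && (i \in W)).

Lemma star_rel_sym (n : nat) (v : 'I_n) (W : {set 'I_n}) : symmetric (star_rel v W).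
Proof. by move=> i j; rewrite /star_rel orbC. Qed.

Lemma star_rel_irr (n : nat) (v : 'I_n) (W : {set 'I_n}) :
  v \notin W -> irreflexive (star_rel v W).
Proof. by move=> vW i; rewrite /star_rel; case: eqVneq => [->|//]; rewrite (negbTE vW). Qed.

Lemma card_ord_lt (n k : nat) : (k <= n)%N -> #|[set i : 'I_n | (i < k)%N]| = k.
Proof.
move=> kn; rewrite cardsE -sum1_card -(big_ord_widen n (fun=> 1%N)) //.
by rewrite sum_nat_const card_ord muln1.
Qed.

Lemma star_compl_iso (n k : nat) (v : 'I_n) (W : {set 'I_n}) :
  (0 < k <= n)%N -> v \notin W -> #|W| = (n - k)%N ->
  graph_iso (compl_rel (star_rel v W)) (Hnk n k).
Proof.
move=> /andP[k0 kn] vW cW.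
have n0 : (0 < n)%N by apply: leq_trans kn.
(* Colour 2 is the vertex off the clique, colour 1 its non-neighbours, colour 0 its neighbours. In
   [Hnk] there are [k.-1] of the latter, which leaves n - k of colour 1. *)
pose a i := if i == v then 2%N else i \in W.
pose b (i : 'I_n) := if i == n.-1 :> nat then 2%N else ~~ (i < k.-1)%N.
have c2a : [set i | a i == 2%N] = [set v]%SET.
  by apply/setP => i; rewrite !inE /a; case: (i == v) => //; case: (i \in W).
have lastP : (n.-1 < n)%N by rewrite ltn_predL.
have c2b : [set i | b i == 2%N] = [set Ordinal lastP]%SET.
  apply/setP => i; rewrite !inE /b -val_eqE /=.
  by case: (nat_of_ord i == n.-1) => //; case: (_ < _)%N.
have c1a : [set i | a i == 1%N] = W.
  apply/setP => i; rewrite !inE /a; case: (eqVneq i v) => [->|_]; first by rewrite (negbTE vW).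
  by case: (i \in W).
have c0b : [set i | b i == 0%N] = [set i : 'I_n | (i < k.-1)%N].
  apply/setP => i; rewrite !inE /b; case: (eqVneq (i : nat) n.-1) => [->|_]; last by case: (_ < _)%N.
  by apply/esym/negbTE; rewrite -leqNgt; lia.
have cover (h : 'I_n -> nat) : (forall i, (h i <= 2)%N) ->
    (#|[set i | h i == 0%N]| + #|[set i | h i == 1%N]| + #|[set i | h i == 2%N]| = n)%N.
  move=> h2; rewrite -[RHS]card_ord -!sum1_card big_mkcond.
  rewrite [X in (_ + X + _)%N]big_mkcond [X in (_ + _ + X)%N]big_mkcond -!big_split /=.
  by apply: eq_bigr => i _; have := h2 i; rewrite !inE; case: (h i) => [|[|[|]]].
have a2 i : (a i <= 2)%N by rewrite /a; case: ifP => // _; case: (_ \in _).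
have b2 i : (b i <= 2)%N by rewrite /b; case: ifP => // _; case: (_ < _)%N.
have ca := cover a a2; have cb := cover b b2.
rewrite c2a c1a cards1 cW in ca; rewrite c2b c0b cards1 card_ord_lt in cb; last by lia.
have [p pE] : exists p : {perm 'I_n}, forall i, b (p i) = a i.
  apply: colored_perm => -[|[|[|c]]].
  - by rewrite c0b card_ord_lt; lia.
  - by rewrite c1a cW; lia.
  - by rewrite c2a c2b !cards1.
  - have -> : [set i | a i == c.+3] = finset.set0.
      by apply/setP => i; rewrite !inE; have := a2 i; lia.
    have -> // : [set i | b i == c.+3] = finset.set0.
    by apply/setP => i; rewrite !inE; have := b2 i; lia.
exists p; split; first by exists (p^-1)%g; [exact: permK | exact: permKV].
move=> i j; rewrite /compl_rel /Hnk (inj_eq perm_inj); case: eqVneq => //= ij.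
have pij : (p i : nat) != p j by rewrite val_eqE (inj_eq perm_inj).
have := pE i; have := pE j; rewrite /a /b /star_rel.
have := ltn_ord (p i); have := ltn_ord (p j).
case: (eqVneq i v) => [iv|_]; case: (eqVneq j v) => [jv|_].
- by rewrite iv jv eqxx in ij.
- by case: (j \in W) => /=; case: ifP; case: ifP; lia.
- by case: (i \in W) => /=; case: ifP; case: ifP; lia.
- by case: (i \in W); case: (j \in W) => /=; case: ifP; case: ifP; lia.
Qed.

(** * Edge forms of a graph, its complement and a star *)

Section Forms.
Variables (R : realType) (n : nat).
Implicit Types (C : rel 'I_n) (x : 'rV[R]_n) (v : 'I_n).

(** The two graphs together are complete: all ordered pairs give 2n |x|^2 + 2 (sum x)^2, from which
    the diagonal terms (2 x_i)^2 are removed. *)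
Lemma edge_form_compl C x : irreflexive C ->
  edge_form (compl_rel C) x + edge_form C x =
  (2 * n%:R - 4) * sqnorm x + 2 * (\sum_i x 0 i) ^+ 2.
Proof.
move=> Cirr; rewrite /edge_form -big_split /=.
transitivity (\sum_i (n%:R * x 0 i ^+ 2 + sqnorm x + 2 * x 0 i * (\sum_j x 0 j) - 4 * x 0 i ^+ 2)).
  apply: eq_bigr => i _; rewrite -big_split /=.
  transitivity (\sum_j ((x 0 i ^+ 2 + x 0 j ^+ 2 + 2 * x 0 i * x 0 j) - (i == j)%:R * (4 * x 0 i ^+ 2))).
    apply: eq_bigr => j _; rewrite /compl_rel; case: eqVneq => [<-|_] /=.
      by rewrite Cirr /=; ring.
    by case: (C i j) => /=; ring.
  rewrite sumrB 2!big_split /= sumr_const card_ord -mulr_sumr; congr (_ - _).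
    by rewrite [n%:R * _]mulr_natl.
  rewrite (bigD1 i) //= eqxx mul1r big1 ?addr0 // => j /negbTE.
  by rewrite eq_sym => ->; rewrite mul0r.
rewrite sumrB 2!big_split /= -!mulr_sumr -mulr_suml -mulr_sumr sumr_const card_ord -/(sqnorm x) -[_ *+ n]mulr_natl.
by ring.
Qed.

Lemma edge_form_split C v x : irreflexive C -> symmetric C ->
  edge_form C x = 2 * (\sum_(u | C v u) (x 0 v + x 0 u) ^+ 2) +
    \sum_(i | i != v) \sum_(j | j != v) (C i j)%:R * (x 0 i + x 0 j) ^+ 2.
Proof.
move=> Cirr Csym; rewrite /edge_form (bigD1 v) //=.
have row0 : \sum_j (C v j)%:R * (x 0 v + x 0 j) ^+ 2 = \sum_(u | C v u) (x 0 v + x 0 u) ^+ 2.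
  by rewrite [RHS]big_mkcond; apply: eq_bigr => j _; case: (C v j); rewrite ?mul1r ?mul0r.
rewrite row0 mulr_natl mulr2n -addrA; congr (_ + _).
under eq_bigr => i iv do rewrite (bigD1 v) //=.
rewrite big_split /=; congr (_ + _).
rewrite -row0 [RHS](bigD1 v) //= Cirr mul0r add0r; apply: eq_bigr => i iv.
by rewrite Csym addrC.
Qed.

Lemma edge_form_star v (W : {set 'I_n}) x : v \notin W ->
  edge_form (star_rel v W) x = 2 * \sum_(u in W) (x 0 v + x 0 u) ^+ 2.
Proof.
move=> vW; rewrite (edge_form_split v _ (star_rel_irr vW) (@star_rel_sym n v W)).
rewrite [X in _ + X]big1 ?addr0 => [|i iv]; last first.
  by rewrite big1 // => j jv; rewrite /star_rel (negbTE iv) (negbTE jv) mul0r.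
congr (2 * _); apply: eq_bigl => u; rewrite /star_rel eqxx /=.
by case: eqVneq => [->|]; rewrite ?(negbTE vW) ?orbF.
Qed.

Lemma degree_sum_split C v : irreflexive C -> symmetric C ->
  (\sum_u deg C u = 2 * deg C v + \sum_(i | i != v) \sum_(j | j != v) C i j)%N.
Proof.
move=> Cirr Csym; rewrite (bigD1 v) //= mul2n -addnn -addnA; congr (_ + _)%N.
under eq_bigr => i iv do rewrite degE (bigD1 v) //=.
rewrite big_split /=; congr (_ + _)%N.
rewrite degE [RHS](bigD1 v) //= Cirr add0n; apply: eq_bigr => i iv.
by rewrite Csym.
Qed.

End Forms.

(* If [a + b] exceeds the upper bound [s] by [m], then [a] and [b] are both at least [m];
   so a deficit above [eps] forces [a ^+ 2 * b ^+ 2] to be large, which is rare. *)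
Lemma edge_deficit (R : realFieldType) (eps s a b : R) :
  0 < eps -> a <= s -> b <= s -> 0 <= 2 - s <= 4 ->
  (2 - s) ^+ 2 - 8 * (eps + a ^+ 2 * b ^+ 2 / eps ^+ 3) <= (2 - a - b) ^+ 2.
Proof.
move=> e0 sa sb /andP[t0 t4]; set X := _ / _.
have X0 : 0 <= X.
  by apply: divr_ge0; [rewrite mulr_ge0 ?sqr_ge0 | rewrite exprn_ge0 ?ltW].
set m := a + b - s; have ma : m <= a by rewrite /m; lra.
have mb : m <= b by rewrite /m; lra.
have mX : m <= eps + X.
  have [me|me] := lerP m eps; first by lra.
  suff : m <= X by lra.
  rewrite ler_pdivlMr ?exprn_gt0 //.
  have m0 : 0 < m by lra.
  apply: le_trans (_ : m * m ^+ 3 <= _).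
    by rewrite ler_pM2l // lerXn2r // ?nnegrE ltW.
  have -> : m * m ^+ 3 = m ^+ 2 * m ^+ 2 by ring.
  by apply: ler_pM; rewrite ?sqr_ge0 // lerXn2r // ?nnegrE; lra.
have : (2 - s) * m <= 4 * (eps + X).
  have [m0|m0] := lerP m 0; first by nra.
  by apply: ler_pM => //; lra.
have := sqr_ge0 m; have -> : 2 - a - b = (2 - s) - m by rewrite /m; ring.
by move=> h1 h2; rewrite sqrrB; lra.
Qed.

(** The largest entry [s] of [e = 1 - y] acts twice: it adds s^2 to |e|^2, and almost every edge of
    [C] costs at least about (2 - s)^2, few edges having two ends with sizeable [e]. Both fit into
    the available 2n + O(1) only if [s] is close to 1 and the other entries of [e] are small. *)
Lemma near_star (R : realType) (n delta : nat) (C : rel 'I_n) (y : 'rV[R]_n) :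
  irreflexive C ->
  10 ^+ 12 <= n%:R :> R -> 40 ^+ 2 * delta%:R <= n%:R :> R ->
  2 * (n%:R - delta%:R) <= (\sum_u deg C u)%:R :> R ->
  sqnorm y = n%:R -> 0 <= \sum_i y 0 i ->
  4 * (n%:R - 2) * n%:R <= edge_form (compl_rel C) y ->
  exists v, `|y 0 v| <= 1/5 /\ forall i, i != v -> `|y 0 i - 1| <= 1/5.
Proof.
move=> Cirr Nbig dN sC yN P0 qbig.
set N : R := n%:R in Nbig dN sC yN qbig *; set d : R := delta%:R in dN sC.
have d0 : 0 <= d by apply: ler0n.
have N8 : 100 <= N by lra.
(* Here 4 is the constant in [NE], and 64 * 400^3 bounds half the error term of [edge_deficit]
   summed over all pairs, using [E <= 4]. [Kbig] determines how large [n] must be. *)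
pose K : R := 4 + 64 * 400 ^+ 3.
have Kbig : K <= N / 200 by rewrite /K; lra.
have dN' : 100 * 16 * d <= N by lra.
clear Nbig dN; have N0 : 0 < N by lra.
have n0 : (0 < n)%N by rewrite -(ltr0n R).
pose e i := 1 - y 0 i.
pose E := \sum_i e i ^+ 2.
set P := \sum_i y 0 i in P0.
have EP : E = 2 * N - 2 * P.
  rewrite /E /e; under eq_bigr do rewrite sqrrB expr1n mul1r.
  rewrite big_split sumrB /= sumr_const card_ord -/(sqnorm y) yN sumrMnl -/P -/N.
  by rewrite mulr_natl mulr2n; lra.
have E0 : 0 <= E by apply: sumr_ge0 => i _; apply: sqr_ge0.
set Phi := edge_form C y.
have Phi0 : 0 <= Phi.
  by apply: sumr_ge0 => i _; apply: sumr_ge0 => j _; rewrite mulr_ge0 ?sqr_ge0 ?ler0n.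
have main : 2 * N ^+ 2 - 4 * N + Phi <= 2 * P ^+ 2.
  by have := edge_form_compl y Cirr; rewrite yN -/N -/P -/Phi; nra.
have PE : P = N - E / 2 by lra.
have E2N : E <= 2 * N by lra.
have Nsq : 2 * P ^+ 2 = 2 * N ^+ 2 - 2 * N * E + E ^+ 2 / 2 by rewrite PE; field.
(* As [E2N] gives E^2 / 2 <= N E, comparing [main] with [Nsq] yields N E <= 4 N. Inserting [E <= 4]
   into the quadratic term again gives the sharper [NE]. *)
have E4 : E <= 4.
  have : N * E <= N * 4 by nra.
  by rewrite ler_pM2l.
have NE : N * E + Phi / 2 <= 2 * N + 4 by nra.
pose v := [arg max_(i > Ordinal n0 | true) e i]%O.
have vmax i : e i <= e v by rewrite /v; case: arg_maxP => // j _ h; apply: h.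
set s := e v in vmax.
have esq i : i != v -> s ^+ 2 + e i ^+ 2 <= E.
  move=> iv; rewrite /E (bigD1 v) //= (bigD1 i) //= addrA lerDl.
  by apply: sumr_ge0 => j _; apply: sqr_ge0.
have sE : s ^+ 2 <= E.
  by rewrite /E (bigD1 v) //= lerDl; apply: sumr_ge0 => j _; apply: sqr_ge0.
have E21 : E <= 21/10.
  have : N * E <= N * (21/10) by lra.
  by rewrite ler_pM2l.
have s15 : s <= 3/2 by nra.
have s15' : - (3/2) <= s by nra.
set t := 2 - s.
have t0 : 0 <= t <= 4 by rewrite /t; lra.
set S : R := (\sum_u deg C u)%:R in sC.
pose eps : R := 1 / 400.
have PhiL : S * (t ^+ 2 - 8 * eps) - 8 / eps ^+ 3 * E ^+ 2 <= Phi.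
  have -> : S = \sum_i \sum_j (C i j)%:R.
    rewrite /S natr_sum; apply: eq_bigr => i _; by rewrite degE natr_sum.
  have -> : E ^+ 2 = \sum_i \sum_j e i ^+ 2 * e j ^+ 2.
    by rewrite expr2 /E mulr_suml; apply: eq_bigr => i _; rewrite mulr_sumr.
  rewrite mulr_suml mulr_sumr -sumrB; apply: ler_sum => i _.
  rewrite mulr_suml mulr_sumr -sumrB; apply: ler_sum => j _.
  have := @edge_deficit R eps s (e i) (e j); rewrite -/t => /(_ _ (vmax i) (vmax j) t0).
  have -> : 2 - e i - e j = y 0 i + y 0 j by rewrite /e; lra.
  move=> /(_ _); have e0 : 0 < eps by rewrite /eps; lra.
  move=> /(_ e0); have : 0 <= e i ^+ 2 * e j ^+ 2 / eps ^+ 3.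
    by apply: divr_ge0; [rewrite mulr_ge0 ?sqr_ge0 | rewrite exprn_ge0 ?ltW].
  rewrite [8 / _ * _]mulrAC -[8 * _ / _]mulrA.
  by case: (C i j); rewrite ?mul1r ?mul0r; lra.
have t2 : 1/4 <= t ^+ 2 <= 16 by rewrite /t; nra.
have e3 : 8 / eps ^+ 3 * E ^+ 2 <= 2 * (K - 4).
  have -> : 8 / eps ^+ 3 = 8 * 400 ^+ 3 by rewrite /eps; field.
  have -> : 2 * (K - 4) = 8 * 400 ^+ 3 * 16 by rewrite /K; ring.
  by rewrite ler_pM2l; [nra | lra].
(* By [t2] the factor [t ^+ 2 - 8 * eps] is positive, so the degree sum may be replaced by its lower
   bound. *)
have S2 : 2 * (N - d) * (t ^+ 2 - 8 * eps) <= S * (t ^+ 2 - 8 * eps).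
  by rewrite ler_wpM2r // /eps; lra.
have dt : d * (t ^+ 2 - 8 * eps) <= d * 16.
  by rewrite ler_wpM2l // /eps; lra.
have fin : N * (E + t ^+ 2) <= N * (204/100).
  rewrite /eps in PhiL S2 dt e3; nra.
rewrite ler_pM2l // in fin.
(* Since s^2 + (2 - s)^2 = 2 + 2 (1 - s)^2, the excess 4/100 in [fin] bounds 2 (1 - s)^2 plus any
   other e_i^2, and 4/100 = (1/5)^2. *)
have sq5 (z : R) : z ^+ 2 <= 1/25 -> `|z| <= 1/5.
  by move=> h; rewrite ler_norml; nra.
exists v; split=> [|i iv]; apply: sq5.
  have -> : y 0 v = 1 - s by rewrite /s /e; ring.
  by rewrite /t in fin; clear - fin sE; nra.
have -> : y 0 i - 1 = - e i by rewrite /e; ring.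
rewrite sqrrN; have := esq i iv; rewrite /t in fin.
by have := sqr_ge0 (1 - s); clear - fin; nra.
Qed.

(** * Comparing a dense complement with a star *)

Lemma compl_relK (n : nat) (G : rel 'I_n) : irreflexive G -> compl_rel (compl_rel G) = G.
Proof.
move=> Girr; apply/funext => i; apply/funext => j; rewrite /compl_rel negb_and !negbK.
by case: eqVneq => [->|] //=; rewrite Girr.
Qed.

Lemma compl_rel_irr (n : nat) (C : rel 'I_n) : irreflexive (compl_rel C).
Proof. by move=> i; rewrite /compl_rel eqxx. Qed.

Lemma compl_rel_sym (n : nat) (C : rel 'I_n) : symmetric C -> symmetric (compl_rel C).
Proof. by move=> Csym i j; rewrite /compl_rel eq_sym Csym. Qed.

Lemma Hnk_sym (n k : nat) : symmetric (Hnk n k).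
Proof.
move=> i j; rewrite /Hnk eq_sym [(j < _)%N && _]andbC; congr (_ && (_ || _)).
by rewrite orbC.
Qed.

Lemma exists_star_leaves (n k : nat) (v : 'I_n) : (0 < k <= n)%N ->
  exists2 W : {set 'I_n}, v \notin W & #|W| = (n - k)%N.
Proof.
move=> /andP[k0 kn]; have [|W WS cW] := @subset_of_card _ (~: [set v])%SET (n - k).
  by rewrite cardsC1 card_ord; lia.
exists W => //; apply/negP => /(fintype.subsetP WS).
by rewrite !inE eqxx.
Qed.

(** The test vector is the indicator of the clique on n - 1 vertices; the bound is the value of q
    for that clique alone. *)
Lemma qG_Hnk_ge (R : realType) (n k : nat) : (1 < n)%N -> (0 < k <= n)%N ->
  2 * (n%:R - 2) <= qG R (Hnk n k).
Proof.
move=> n1 kn; have n0 : (0 < n)%N by lia.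
pose v := Ordinal n0; have [W vW cW] := exists_star_leaves v kn.
have Ssym := compl_rel_sym (@star_rel_sym n v W).
have Sirr := star_rel_irr vW.
have iso := star_compl_iso kn vW cW.
rewrite -(qG_iso R n0 Ssym (@Hnk_sym n k) iso).
have [_ /(_ (\row_i (i != v)%:R))] := qG_eigen R n0 Ssym.
have n1R : (1 : R) < n%:R by rewrite ltr1n.
have cnt : \sum_(i < n) (i != v)%:R = n%:R - 1 :> R.
  rewrite -natr_sum -(natrB _ n0); congr _%:R.
  rewrite (bigD1 v) //= add0n (eq_bigr (fun=> 1%N)) => [|i ->] //.
  by rewrite sum_nat_const cardC1 card_ord muln1 subn1.
move: (edge_form_compl (\row_i (i != v)%:R : 'rV[R]_n) Sirr).
have -> : sqnorm (\row_i (i != v)%:R : 'rV[R]_n) = n%:R - 1.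
  by rewrite -cnt; apply: eq_bigr => i _; rewrite mxE; case: (i != v); rewrite ?expr1n ?expr0n.
have -> : \sum_i (\row_i (i != v)%:R : 'rV[R]_n) 0 i = n%:R - 1.
  by rewrite -cnt; apply: eq_bigr => i _; rewrite mxE.
have -> : edge_form (star_rel v W) (\row_i (i != v)%:R : 'rV[R]_n) = 2 * (n%:R - k%:R).
  rewrite edge_form_star //; congr (2 * _).
  rewrite (eq_bigr (fun=> 1)) => [|u uW].
    by rewrite sumr_const cW natrB //; case/andP: kn.
  by rewrite !mxE eqxx; case: eqVneq uW => [->|_ _]; rewrite ?(negbTE vW) // add0r expr1n.
have k1 : (1 : R) <= k%:R by rewrite ler1n; case/andP: kn.
set q := qG _ _; set X := edge_form _ _; move: n1R k1; set N : R := n%:R; set K : R := k%:R.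
move=> n1R k1 h1 h2; have : 2 * (N - 2) * (N - 1) <= q * (N - 1) by nra.
by rewrite ler_pM2r // subr_gt0.
Qed.

Lemma qG_dense_le (R : realType) (n k : nat) (C : rel 'I_n) :
  irreflexive C -> symmetric C -> (10 ^ 12 <= n)%N -> (0 < k)%N -> (40 ^ 2 * k <= n)%N ->
  (2 * (n - k) <= \sum_u deg C u)%N ->
  qG R (compl_rel C) < qG R (Hnk n k) \/ graph_iso (compl_rel C) (Hnk n k).
Proof.
move=> Cirr Csym nbig k0 kn dC.
have n1 : (1 < n)%N by apply: leq_trans nbig; rewrite (ltn_exp2l 0).
(* Keeps [done] from evaluating the unary numeral [10 ^ 12]. *)
have {nbig} NB : 10 ^+ 12 <= n%:R :> R by rewrite -natrX ler_nat; exact nbig.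
have [|qle] := ltP (qG R (compl_rel C)) (qG R (Hnk n k)); [by left | right].
have n0 : (0 < n)%N by apply: ltnW.
have kn' : (k <= n)%N by lia.
have Gsym := compl_rel_sym Csym.
have [x [xn xpos xq]] := qG_attained R n0 Gsym.
have NR0 : (0 : R) < n%:R by rewrite ltr0n.
have nk : n%:R - k%:R = (n - k)%:R :> R by rewrite natrB.
have qH : 2 * (n%:R - 2) <= qG R (Hnk n k) by apply: qG_Hnk_ge; rewrite ?k0.
have scale (a b : R) : a <= b -> 2 * a * n%:R <= 2 * b * n%:R.
  by move=> ab; rewrite ler_wpM2r ?ler0n // ler_wpM2l ?ler0n.
have star_le u (W : {set 'I_n}) : u \notin W -> #|W| = (n - k)%N ->
    edge_form (compl_rel (star_rel u W)) x <= edge_form (compl_rel C) x.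
  move=> uW cW.
  have Ssym := compl_rel_sym (@star_rel_sym n u W).
  have iso : graph_iso (compl_rel (star_rel u W)) (Hnk n k).
    by apply: star_compl_iso; rewrite ?k0.
  have [_ /(_ x) le] := qG_eigen R n0 Ssym; apply: le_trans le _.
  rewrite (qG_iso R n0 Ssym (@Hnk_sym n k) iso) xn xq; exact: scale.
have xbig : 4 * (n%:R - 2) * n%:R <= edge_form (compl_rel C) x.
  have -> : 4 * (n%:R - 2) = 2 * (2 * (n%:R - 2)) :> R by ring.
  by rewrite xq; apply: scale; exact: le_trans qH qle.
clear qle qH xq.
have [v [xv xu]] : exists v, `|x 0 v| <= 1/5 /\ forall i, i != v -> `|x 0 i - 1| <= 1/5.
  apply: (@near_star _ _ k C) => //.
  - by rewrite -natrX -natrM ler_nat.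
  - by rewrite nk -natrM ler_nat.
clear NB kn xbig.
(* A missing edge at [v] costs at most (1/5 + 6/5)^2 < 2, one away from [v] at least (4/5 + 4/5)^2 >
   5/2. This gap drives the comparison. *)
pose c u := (x 0 v + x 0 u) ^+ 2.
have bv : -(1/5) <= x 0 v <= 1/5 by move: xv; rewrite ler_norml.
have bu u : u != v -> 4/5 <= x 0 u <= 6/5 by move/xu; rewrite ler_norml; lra.
have c_le u : u != v -> c u <= 2 by move/bu; rewrite /c; nra.
have c_gt0 u : u != v -> 0 < c u by move/bu => h; rewrite exprn_gt0 //; lra.
have noC u : C v u -> u != v by apply: contraTneq => ->; rewrite Cirr.
pose W0 := [set u | C v u].
pose s1 := (\sum_(i | i != v) \sum_(j | j != v) C i j)%N.
have s1E := degree_sum_split v Cirr Csym.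
have PhiC : 2 * \sum_(u in W0) c u + 5/2 * s1%:R <= edge_form C x.
  rewrite (edge_form_split v) // (eq_bigl (C v)) => [|u]; last by rewrite inE.
  rewrite lerD2l /s1 natr_sum mulr_sumr; apply: ler_sum => i iv.
  rewrite natr_sum mulr_sumr; apply: ler_sum => j jv; rewrite mulrC.
  by rewrite ler_wpM2l //; have := bu i iv; have := bu j jv; nra.
(* Passing to complements reverses [star_le]: no star with n - k edges costs less on [x] than
   [C]. *)
have starle (W : {set 'I_n}) : v \notin W -> #|W| = (n - k)%N ->
    2 * \sum_(u in W0) c u + 5/2 * s1%:R <= 2 * \sum_(u in W) c u.
  move=> vW cW; apply: le_trans PhiC _; rewrite -edge_form_star //.
  have Sirr := star_rel_irr vW.
  have := edge_form_compl x Sirr; have := edge_form_compl x Cirr.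
  have := star_le v W vW cW; lra.
have degW0 : deg C v = #|W0| by [].
(* If [v] already has n - k missing edges, a star inside them costs no more than [C], so every
   surplus edge has cost zero and cannot exist. *)
have [W0big|W0small] := leqP (n - k) #|W0|.
  have [W WW0 cW] := subset_of_card W0big.
  have vW : v \notin W.
    by apply/negP => /(fintype.subsetP WW0); rewrite inE Cirr.
  have split : \sum_(u in W0) c u = \sum_(u in W) c u + \sum_(u in W0 :\: W) c u.
    rewrite (big_setID W) /=; congr (_ + _).
    by rewrite (finset.setIidPr WW0).
  have le := starle W vW cW; rewrite split in le.
  have rest0 : 0 <= \sum_(u in W0 :\: W) c u by apply: sumr_ge0 => u _; apply: sqr_ge0.
  have s10 : s1 = 0%N.
    by apply/eqP; rewrite -(pnatr_eq0 R) eq_le ler0n andbT; lra.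
  have WE : W = W0.
    apply/eqP; rewrite finset.eqEsubset WW0 -finset.setD_eq0; apply/eqP/setP => u; rewrite finset.in_set0.
    apply/negP => uD; have : c u <= \sum_(u in W0 :\: W) c u.
      by rewrite (bigD1 u) //= lerDl; apply: sumr_ge0 => w _; apply: sqr_ge0.
    have : 0 < c u by apply: c_gt0; apply: noC; move: uD; rewrite !inE => /andP[].
    have : (0 : R) <= s1%:R by apply: ler0n.
    lra.
  suff -> : C = star_rel v W by apply: star_compl_iso; rewrite ?k0.
  apply/funext => i; apply/funext => j; rewrite /star_rel WE !inE.
  have [->|iv] := eqVneq i v.
    by have [->|jv] := eqVneq j v; rewrite ?Cirr ?orbF.
  have [->|jv] := eqVneq j v; first by rewrite Csym.
  apply/negP => Cij; move/eqP: s10; rewrite sum_nat_eq0 => /forall_inP/(_ i iv).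
  by rewrite sum_nat_eq0 => /forall_inP/(_ j jv); rewrite Cij.
(* Otherwise the star is completed with m = n - k - |W0| > 0 new leaves, adding at most 4m in
   ordered pairs. At least m edges of [C] avoid [v], and these cost at least 5m, a contradiction. *)
have [|U US cU] := @subset_of_card _ (~: (v |: W0))%SET (n - k - #|W0|).
  by rewrite [#|~: _|%SET]cardsCs finset.setCK cardsU1 inE Cirr card_ord; lia.
have UE u : u \in U -> u != v /\ u \notin W0.
  by move/(fintype.subsetP US); rewrite !inE negb_or => /andP[].
have dis : [disjoint W0 & U].
  by rewrite disjoint_sym finset.disjoints_subset; apply/fintype.subsetP => u /UE[_]; rewrite finset.in_setC.
have cWU : #|W0 :|: U| = (n - k)%N.
  by rewrite finset.cardsU finset.disjoint_setI0 // cards0 cU; lia.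
have : v \notin W0 :|: U.
  by rewrite !inE Cirr /=; apply/negP => /UE[]; rewrite eqxx.
move/starle/(_ cWU).
have -> : \sum_(u in W0 :|: U) c u = \sum_(u in W0) c u + \sum_(u in U) c u.
  rewrite -bigU //; apply: eq_bigl => u; exact: finset.in_setU.
have : \sum_(u in U) c u <= 2 * (n - k - #|W0|)%:R.
  rewrite -cU mulr_natr -sumr_const; apply: ler_sum => u /UE[uv _]; exact: c_le.
have : (2 * (n - k - #|W0|))%:R <= s1%:R :> R by rewrite ler_nat; lia.
have : (0 : R) < (n - k - #|W0|)%:R by rewrite ltr0n; lia.
rewrite natrM; lra.
Qed.

(** * The dichotomy on the number of missing edges *)

Theorem theorem1p7 :
  exists n0 : nat, forall (R : realType) (n : nat), (n0 <= n)%N ->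
  forall (F : rel 'I_n) (delta : nat),
    simple_graph F ->
    (forall v, (0 < deg F v)%N) ->
    (exists v, deg F v = delta) -> (forall v, (delta <= deg F v)%N) ->
    (forall v, (deg F v)%:R <= Num.sqrt (n%:R : R) / 40) ->
  forall G : rel 'I_n, simple_graph G -> ~ contains_copy F G ->
    qG R G <= qG R (Hnk n delta) /\
    (qG R G = qG R (Hnk n delta) <-> graph_iso G (Hnk n delta)).
Proof.
exists (10 ^ 12)%N => R n nbig F delta [Firr Fsym] Fpos [b db] dmin dmax G [Girr Gsym] nocopy.
have n4 : (100 * 100 <= n)%N.
  by apply: leq_trans nbig; rewrite (leq_exp2l 4 12 (isT : (1 < 10)%N)).
have n0 : (0 < n)%N by apply: leq_ltn_trans (ltn_ord b).
have degsq v : (1600 * (deg F v * deg F v) <= n)%N.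
  rewrite -(ler_nat R) !natrM -[leRHS]sqr_sqrtr ?ler0n //.
  have := dmax v; rewrite ler_pdivlMr ?ltr0n // => h.
  have -> : 1600 * ((deg F v)%:R * (deg F v)%:R) = ((deg F v)%:R * 40) ^+ 2 :> R by ring.
  by rewrite lerXn2r // nnegrE ?sqrtr_ge0 // mulr_ge0 ?ler0n.
have d0 : (0 < delta)%N by rewrite -db.
have [v _ vmax] := @arg_maxnP _ b (fun _ => true) (fun v => deg F v) isT.
pose C := compl_rel G.
have Cirr : irreflexive C by apply: compl_rel_irr.
have Csym : symmetric C by apply: compl_rel_sym.
have [sparse|dense] := ltnP (\sum_u deg C u) (2 * (n - deg F b)).
  case: nocopy.
  have [f fE] := @sparse_packing n (deg F v) F C b n4 (degsq v) Firr Fsym Cirr Csym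
    (fun w => vmax w isT) sparse.
  (* The packing sends vertices of [G] to vertices of [F], so the copy of [F] is given by its
     inverse. *)
  exists (f^-1)%g; split=> [|x y Fxy]; first exact: perm_inj.
  apply: contraT => nG; have : C ((f^-1)%g x) ((f^-1)%g y).
    by rewrite /C /compl_rel nG andbT (inj_eq perm_inj); apply: contraTneq Fxy => ->; rewrite Firr.
  by move/fE; rewrite !permKV Fxy.
have dsmall : (40 ^ 2 * delta <= n)%N.
  by have := degsq b; rewrite db; clear nbig; nia.
rewrite db in dense.
have := qG_dense_le R Cirr Csym nbig d0 dsmall dense; rewrite (compl_relK Girr) => -[lt|iso].
  split; first exact: ltW.
  split=> [eq|iso]; first by rewrite eq ltxx in lt.
  exact: qG_iso n0 Gsym (@Hnk_sym n delta) iso.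
rewrite (qG_iso R n0 Gsym (@Hnk_sym n delta) iso).
by split; [exact: lexx | split].
Qed.
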